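(* Let $P,Q,t_0,t_1\in\mathbb{C}$ with $Q\neq 0$, and let $(T_n)_{n\in\mathbb{Z}}$ be the bi-infinite sequence determined by $T_{n+2}=PT_{n+1}-QT_n$ for all $n\in\mathbb{Z}$ and $(T_0,T_1)=(t_0,t_1)$. Then $(T_n)$ is a solution of the Somos-4 recurrence $$T_nT_{n+4}=\alpha\,T_{n+1}T_{n+3}+\beta\,T_{n+2}^2\qquad (n\in\mathbb{Z})$$ with coefficients $$\alpha=\frac{P^2}{Q},\qquad \beta=-\frac{P^2-Q}{Q}$$ and initial data $$(T_0,T_1,T_2,T_3)=\left(t_0,\;t_1,\;-t_0Q+t_1P,\;-t_0QP+t_1(P^2-Q)\right).$$ Moreover, for all $(n,m,u,s)\in\mathbb{Z}^4$, $$W_uW_{u+s}T_{n-m}T_{n+m+s}-W_mW_{m+s}T_{n-u}T_{n+u+s}+W_{m-u}W_{u+m+s}T_nT_{n+s}=0,$$ where $W_n=D_n/Q^{(n-1)/2}$.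
   Context: $(D_n)_{n\in\mathbb{Z}}$ is the Lucas sequence with parameters $P,Q$: the bi-infinite sequence with $D_0=0$, $D_1=1$ and $D_{n+2}=PD_{n+1}-QD_n$ for all $n\in\mathbb{Z}$; equivalently it is extended to negative indices by $D_{-n}=-D_n/Q^n$. In the definition of $W_n$, a square root $Q^{1/2}$ is fixed once and for all and $Q^{(n-1)/2}=(Q^{1/2})^{n-1}$. *)

(* Defs.v *)
From HB Require Import structures.
From mathcomp Require Import all_boot all_order all_algebra.
From mathcomp Require Import ring zify.
From mathcomp.real_closed Require Import complex.
From mathcomp Require Import reals.

Set Implicit Arguments.
Unset Strict Implicit.
Unset Printing Implicit Defensive.
Import Order.TTheory GRing.Theory Num.Theory.
Local Open Scope ring_scope.

Definition linear_rec2 (K : fieldType) (P Q t0 t1 : K) (T : int -> K) : Prop :=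
  [/\ forall n : int, T (n + 2) = P * T (n + 1) - Q * T n,
      T 0 = t0 & T 1 = t1].

Definition lucas_sequence (K : fieldType) (P Q : K) (D : int -> K) : Prop :=
  linear_rec2 P Q 0 1 D.

Definition somos4 (K : fieldType) (alpha beta : K) (T : int -> K) : Prop :=
  forall n : int,
    T n * T (n + 4) =
      alpha * T (n + 1) * T (n + 3) + beta * T (n + 2) ^+ 2.

(* W_n = D_n / Q^((n-1)/2), where the argument q is the fixed square root of
   Q and (q ^ k) is the power with integer exponent k. *)
Definition normalized_lucas (K : fieldType) (q : K) (D : int -> K) (n : int) : K :=
  D n / q ^ (n - 1).

(* For Q <> 0 the predicate linear_rec2 determines exactly one sequence. *)
Lemma linear_rec2_exists (K : fieldType) (P Q t0 t1 : K) (hQ : Q != 0) :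
  exists T : int -> K, linear_rec2 P Q t0 t1 T.
Proof.
pose up (p : K * K) := (p.2, P * p.2 - Q * p.1).
pose down (p : K * K) := ((P * p.1 - p.2) / Q, p.1).
have du p : up (down p) = p by case: p => a b; rewrite /up /=; congr pair; field.
pose S (n : int) := match n with
  | Posz k => iter k up (t0, t1) | Negz k => iter k.+1 down (t0, t1) end.
have SS n : S (n + 1) = up (S n).
  case: n => k; first by rewrite -PoszD addn1.
  rewrite /S iterS du; case: k => [|k] //.
  by have -> : Negz k.+1 + 1 = Negz k by lia.
exists (fun n => (S n).1); split => // n.
by rewrite (_ : n + 2 = n + 1 + 1) ?SS //; lia.
Qed.

Lemma linear_rec2_unique (K : fieldType) (P Q t0 t1 : K) (hQ : Q != 0)
    (T U : int -> K) :
  linear_rec2 P Q t0 t1 T -> linear_rec2 P Q t0 t1 U -> T =1 U.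
Proof.
move=> [rT T0 T1] [rU U0 U1].
suff H n : T n = U n /\ T (n + 1) = U (n + 1) by move=> n; case: (H n).
elim/int_ind: n => [|n [IH1 IH2]|n [IH1 IH2]].
- by rewrite add0r T0 T1 U0 U1.
- have -> : n.+1%:Z = n%:Z + 1 by lia.
  split=> //; have -> : n%:Z + 1 + 1 = n%:Z + 2 by lia.
  by rewrite rT rU IH1 IH2.
- set m := - n.+1%:Z; have e1 : m + 1 = - n%:Z by lia.
  have e2 : m + 2 = - n%:Z + 1 by lia.
  have := rT m; have := rU m; rewrite e1 e2 -IH1 -IH2 => -> /addrI /oppr_inj.
  by move/(mulfI hQ).
Qed.

(* Main.v *)
(* Dividing T_n by q^n and D_n by q^(n-1) reduces everything to Q = 1, where a
   solution T with parameter p satisfies the Catalan-type identity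
     T_(n-m) T_(n+m+s) - T_n T_(n+s) = - K_n W_m W_(m+s),
   with K_n = T_(n+1)^2 - p T_n T_(n+1) + T_n^2 independent of m. Using it for m
   and for u eliminates K_n, and the remaining relation between the W's is the
   same identity applied to W itself, where K_n = 1. *)

Require Import Defs.
From HB Require Import structures.
From mathcomp Require Import all_boot all_order all_algebra.
From mathcomp Require Import ring zify.
From mathcomp.real_closed Require Import complex.
From mathcomp Require Import reals.

Set Implicit Arguments.
Unset Strict Implicit.
Unset Printing Implicit Defensive.
Import Order.TTheory GRing.Theory Num.Theory.
Local Open Scope ring_scope.
Local Open Scope complex_scope.

Section UnitParameter.
Variables (K : fieldType) (p t0 t1 : K) (T W : int -> K).
Hypotheses (hT : linear_rec2 p 1 t0 t1 T) (hW : lucas_sequence p 1 W).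

(** As functions of [m], both sides solve the recurrence with initial values [T n] and [T (n + 1)],
    so uniqueness applies. The factor [p * W m - W (m + 1)] is [W (m - 1)]. *)
Lemma linear_rec2_add (n m : int) :
  T (n + m) = W m * T (n + 1) - (p * W m - W (m + 1)) * T n.
Proof.
case: hT => rT _ _; case: hW => rW W0 W1.
have W2 : W 2 = p by rewrite -[2]add0r rW add0r W0 W1; ring.
move: m; apply: (@linear_rec2_unique _ p 1 (T n) (T (n + 1)) (oner_neq0 _)).
- split=> [k||]; last by [].
  + by rewrite (addrA n k 2) (addrA n k 1) rT.
  + by rewrite addr0.
- split=> [k||].
  + rewrite (_ : k + 2 + 1 = k + 1 + 2); last by lia.
    by rewrite !rW (_ : k + 1 + 1 = k + 2) ?rW; [ring | lia].
  + by rewrite add0r W0 W1; ring.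
  + by rewrite W1 (_ : 1 + 1 = 2 :> int) // W2; ring.
Qed.

(** With second parameter 1 the recurrence is invariant under reversal of the index, so [- W (- m)]
    solves it with initial values 0 and 1. *)
Lemma lucas_opp (m : int) : W (- m) = - W m.
Proof.
case: hW => rW W0 W1; apply: (canRL opprK); move: m.
apply: (@linear_rec2_unique _ p 1 0 1 (oner_neq0 _)) => //.
split=> [k||].
- have := rW (- (k + 2)).
  rewrite (_ : - (k + 2) + 2 = - k); last by lia.
  by rewrite (_ : - (k + 2) + 1 = - (k + 1)); [move=> -> ; ring | lia].
- by rewrite oppr0 W0 oppr0.
- have := rW (- 1); rewrite (_ : - 1 + 2 = 1 :> int) // addNr W0 W1 => ->.
  by ring.
Qed.

Lemma linear_rec2_sub (n m : int) :
  T (n - m) = W (m + 1) * T n - W m * T (n + 1).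
Proof.
case: hW => rW _ _; have := rW (m - 1).
rewrite (_ : m - 1 + 2 = m + 1); last by lia.
rewrite subrK => ->.
rewrite linear_rec2_add lucas_opp (_ : - m + 1 = - (m - 1)) ?lucas_opp; last by lia.
by ring.
Qed.

End UnitParameter.

Lemma linear_rec2_catalan (K : fieldType) (p t0 t1 : K) (T W : int -> K)
    (hT : linear_rec2 p 1 t0 t1 T) (hW : lucas_sequence p 1 W) (n m s : int) :
  T (n - m) * T (n + m + s) = T n * T (n + s)
    - (T (n + 1) ^+ 2 - p * T n * T (n + 1) + T n ^+ 2) * (W m * W (m + s)).
Proof.
have rW : forall k, W (k + 2) = p * W (k + 1) - 1 * W k by case: hW.
(* Writing [s] as [(m + s) - m] leaves a polynomial identity in [T] at [n], [n + 1] and [W] at [m],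
   [m + 1], [m + s], [m + s + 1]. *)
have Ws : W s = W (m + 1) * W (m + s) - W m * W (m + s + 1).
  by rewrite -(linear_rec2_sub hW hW); congr W; lia.
have Ws1 : W (s + 1) = W (m + 1) * W (m + s + 1) - W m * W (m + s + 2).
  rewrite (_ : m + s + 2 = m + s + 1 + 1); last by lia.
  by rewrite -(linear_rec2_sub hW hW); congr W; lia.
rewrite -(addrA n m s) (linear_rec2_sub hT hW).
rewrite (linear_rec2_add hT hW n (m + s)) (linear_rec2_add hT hW n s) Ws Ws1 rW.
by ring.
Qed.

(** This is [W 1 = 1], with [W ((n + 1) - n)] expanded by the subtraction formula. *)
Lemma lucas_invariant (K : fieldType) (p : K) (W : int -> K)
    (hW : lucas_sequence p 1 W) (n : int) :
  W (n + 1) ^+ 2 - p * W n * W (n + 1) + W n ^+ 2 = 1.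
Proof.
have [rW _ W1] := hW; have := linear_rec2_sub hW hW (n + 1) n.
rewrite (_ : n + 1 - n = 1); last by lia.
rewrite (_ : n + 1 + 1 = n + 2); last by lia.
by rewrite rW W1 => ->; ring.
Qed.

Lemma linear_rec2_three_term (K : fieldType) (p t0 t1 : K) (T W : int -> K)
    (hT : linear_rec2 p 1 t0 t1 T) (hW : lucas_sequence p 1 W)
    (n m u s : int) :
  W u * W (u + s) * (T (n - m) * T (n + m + s))
  - W m * W (m + s) * (T (n - u) * T (n + u + s))
  + W (m - u) * W (u + m + s) * (T n * T (n + s)) = 0.
Proof.
rewrite !(linear_rec2_catalan hT hW) (addrC u m).
(* This turns [W (m - u) * W (m + u + s)] into [W m * W (m + s) - W u * W (u + s)]. *)
rewrite (linear_rec2_catalan hW hW) (lucas_invariant hW).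
by ring.
Qed.

(** Dividing by powers of [q] divides both characteristic roots by [q], so their product becomes 1.
    The offset [c] is 0 for [T] and 1 for [D]. *)
Lemma linear_rec2_normalize (K : fieldType) (P q t0 t1 : K) (T : int -> K) (c : int) :
  q != 0 -> linear_rec2 P (q ^+ 2) t0 t1 T ->
  linear_rec2 (P / q) 1 (t0 / q ^ (- c)) (t1 / q ^ (1 - c))
    (fun n => T n / q ^ (n - c)).
Proof.
move=> q0 [rT T0 T1]; split=> [n||]; rewrite ?T0 ?T1 ?sub0r //.
rewrite (_ : n + 2 - c = (n - c) + 1 + 1); last by lia.
rewrite (_ : n + 1 - c = (n - c) + 1); last by lia.
by rewrite !(expfzDr _ _ q0) expr1z rT; field; rewrite !expfz_neq0.
Qed.

Lemma linear_rec2_somos4 (K : fieldType) (P Q t0 t1 : K) (T : int -> K) :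
  Q != 0 -> linear_rec2 P Q t0 t1 T ->
  somos4 (P ^+ 2 / Q) (- ((P ^+ 2 - Q) / Q)) T.
Proof.
move=> Q0 [rT _ _] n.
rewrite (_ : n + 4 = n + 2 + 2) ?rT; last by lia.
rewrite (_ : n + 2 + 1 = n + 1 + 2) ?rT; last by lia.
rewrite (_ : n + 3 = n + 1 + 2) ?rT; last by lia.
rewrite (_ : n + 1 + 1 = n + 2) ?rT; last by lia.
by field.
Qed.

Theorem theorem4p3 (R : realType) (P Q t0 t1 : R[i]) (hQ : Q != 0)
    (T : int -> R[i]) (hT : linear_rec2 P Q t0 t1 T)
    (D : int -> R[i]) (hD : lucas_sequence P Q D)
    (q : R[i]) (hq : q ^+ 2 = Q) :
  let W := normalized_lucas q D in
  [/\ somos4 (P ^+ 2 / Q) (- ((P ^+ 2 - Q) / Q)) T,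
      (T 0, T 1, T 2, T 3) =
        (t0, t1, - t0 * Q + t1 * P, - t0 * Q * P + t1 * (P ^+ 2 - Q))
    & forall n m u s : int,
        W u * W (u + s) * T (n - m) * T (n + m + s)
        - W m * W (m + s) * T (n - u) * T (n + u + s)
        + W (m - u) * W (u + m + s) * T n * T (n + s) = 0].
Proof.
move=> W; have q0 : q != 0 by apply: contraNneq hQ => q0; rewrite -hq q0 expr0n.
split; first exact: linear_rec2_somos4 hT.
  case: hT => rT <- <-.
  have T2 : T 2 = P * T 1 - Q * T 0 by exact: rT 0.
  have T3 : T 3 = P * T 2 - Q * T 1 by exact: rT 1.
  rewrite T3 T2.
  by congr (_, _, _, _); ring.
move=> n m u s; rewrite -hq in hT hD.
have hW : lucas_sequence (P / q) 1 W.
  by have := linear_rec2_normalize 1 q0 hD; rewrite mul0r subrr expr0z divr1.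
have hS := linear_rec2_normalize 0 q0 hT.
have TE k l : T k * T l = q ^ (k + l) * (T k / q ^ (k - 0) * (T l / q ^ (l - 0))).
  rewrite !subr0 expfzDr //.
  have qk : q ^ k != 0 by rewrite expfz_neq0.
  have ql : q ^ l != 0 by rewrite expfz_neq0.
  by field; rewrite qk ql.
rewrite -(mulrA (W u * _)) -(mulrA (W m * _)) -(mulrA (W (m - u) * _)) !TE.
(* All three products of [T] have index sum [2n + s], so one common power of [q] factors out. *)
have -> : n - m + (n + m + s) = n + (n + s) by lia.
have -> : n - u + (n + u + s) = n + (n + s) by lia.
rewrite !(mulrCA _ (q ^ _)) -mulrBr -mulrDr.
by rewrite (linear_rec2_three_term hS hW n m u s) mulr0.
Qed.
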